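(* Let $(X,\leq,\gamma)$ be an $(\mathsf{i},\mathsf{H})$-dialgebra with filter extension $(\hat X,\subseteq,\hat\gamma)$. Two states $x,y\in X$ are logically equivalent (satisfy the same formulas) if and only if $\eta(x),\eta(y)\in\hat X$ are behaviourally equivalent, i.e. there is an $(\mathsf{i},\mathsf{H})$-dialgebra morphism $f$ from $(\hat X,\subseteq,\hat\gamma)$ to some $(\mathsf{i},\mathsf{H})$-dialgebra with $f(\eta(x))=f(\eta(y))$.
   Context: An I-frame is an implicative meet-semilattice with top viewed as a poset; an I-frame morphism preserves finite meets and satisfies: $f(x)\leq y'$ implies $\exists y\geq x$, $f(y)=y'$. A filter is a non-empty up-closed subset closed under finite meets; $\mathcal{F}(X,\leq)$ is the set of filters. $\mathsf{H}(X,\leq)$ is the set of $W\subseteq\mathcal{F}(X,\leq)$ that are up-closed under inclusion, ordered by inclusion (meet $\cap$, top $\mathcal{F}(X,\leq)$); for an I-frame morphism $h$, $\mathsf{H}h(W)=\{a'\mid h^{-1}(a')\in W\}$. An $(\mathsf{i},\mathsf{H})$-dialgebra is $(X,\leq,\gamma)$ with $(X,\leq)$ an I-frame and $\gamma:X\to\mathsf{H}(X,\leq)$ preserving finite meets; a morphism is an I-frame morphism $f$ with $\mathsf{H}f\circ\gamma=\gamma'\circ f$. Formulas (no proposition letters): $\phi::=\top\mid\phi\wedge\phi\mid\phi\to\phi\mid\triangle\phi$ with $[\![\top]\!]=X$, $\wedge$ as $\cap$, $[\![\phi\to\psi]\!]=\{x\mid\forall y\geq x,\ y\in[\![\phi]\!]\Rightarrow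 y\in[\![\psi]\!]\}$, $[\![\triangle\phi]\!]=\{x\mid[\![\phi]\!]\in\gamma(x)\}$. The filter extension has $\hat X$ the set of filters of the semilattice $(\mathcal{F}(X,\leq),\cap,X)$, ordered by inclusion, and $\eta(x)=\{a\in\mathcal{F}(X,\leq)\mid x\in a\}$. For $a\in\mathcal{F}(X,\leq)$ let $\tilde a=\{q\in\hat X\mid a\in q\}$ (the clopen filters of $\hat X$); a filter of $\hat X$ is closed if it is the intersection of all clopen filters containing it. For $p\in\hat X$ and a filter $U$ of $(\hat X,\subseteq)$: if $U=\tilde a$, then $U\in\hat\gamma(p)$ iff $\{x\in X\mid a\in\gamma(x)\}\in p$; if $U$ is closed, $U\in\hat\gamma(p)$ iff all clopen filters containing $U$ are in $\hat\gamma(p)$; for arbitrary $U$, $U\in\hat\gamma(p)$ iff some closed filter $C\subseteq U$ lies in $\hat\gamma(p)$. *)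

(* Defs.v *)
From HB Require Import structures.
From mathcomp Require Import all_boot all_order.
From mathcomp Require Import boolp classical_sets.

Set Implicit Arguments.
Unset Strict Implicit.
Unset Printing Implicit Defensive.

Import Order.TTheory.
Local Open Scope order_scope.

HB.mixin Record isImplicative d X of Order.TMeetSemilattice d X := {
  imp : X -> X -> X;
  leIimp : forall x y z : X, (x `&` y <= z) = (x <= imp y z)
}.

#[short(type="iFrameType")]
HB.structure Definition IFrame d :=
  { X of isImplicative d X & Order.TMeetSemilattice d X }.

Record iframe_hom d d' (X : iFrameType d) (Y : iFrameType d') := IFrameHom {
  hom_fun :> X -> Y;
  hom_top : hom_fun \top = \top;
  hom_meet : forall x y, hom_fun (x `&` y) = hom_fun x `&` hom_fun y;
  hom_back : forall x y', hom_fun x <= y' ->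
    exists y, x <= y /\ hom_fun y = y'
}.

Lemma hom_le d d' (X : iFrameType d) (Y : iFrameType d')
  (h : iframe_hom X Y) x y : x <= y -> h x <= h y.
Proof. by move=> /meet_idPl <-; rewrite hom_meet leIr. Qed.

Definition upclosed d (X : porderType d) (A : set X) :=
  forall x y, x <= y -> A x -> A y.

Record is_filter d (X : iFrameType d) (a : set X) : Prop := IsFilter {
  filter_ex : exists x, a x;
  filter_up : upclosed a;
  filter_meet : forall x y, a x -> a y -> a (x `&` y)
}.

Record filt d (X : iFrameType d) := Filt {
  filt_set :> X -> Prop;
  filtP : is_filter filt_set
}.

Section FilterFrame.
Context d (X : iFrameType d).
Implicit Types a b c : filt X.

Lemma filt_ext a b : (forall x, a x <-> b x) -> a = b.
Proof.
case: a b => [a Ha] [b Hb] /= E.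
have {}E : a = b by apply/funext => x; apply/propext.
by subst b; congr Filt; apply: Prop_irrelevance.
Qed.

Lemma filt_top a : a \top.
Proof. by have [x ax] := filter_ex (filtP a); apply: filter_up (lex1 x) ax; case: a. Qed.

Definition filt_le a b : bool := `[< forall x, a x -> b x >].

Lemma filt_leP a b : reflect (forall x, a x -> b x) (filt_le a b).
Proof. exact: asboolP. Qed.

Lemma filt_le_refl : reflexive filt_le.
Proof. by move=> a; apply/filt_leP. Qed.

Lemma filt_le_anti : antisymmetric filt_le.
Proof.
move=> a b /andP[/filt_leP ab /filt_leP ba].
by apply: filt_ext => x; split; [apply: ab | apply: ba].
Qed.

Lemma filt_le_trans : transitive filt_le.
Proof.
by move=> b a c /filt_leP ab /filt_leP bc; apply/filt_leP => x /ab /bc.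
Qed.

Lemma is_filter_setT : is_filter [set: X].
Proof. by split; [exists \top | |]. Qed.

Definition filt_setT : filt X := Filt is_filter_setT.

Lemma is_filter_setI a b : is_filter [set x | a x /\ b x]%classic.
Proof.
split=> [|x y xy [ax bx]|x y [ax bx] [ay bY]].
- by exists \top; split; apply: filt_top.
- by split; [apply: filter_up xy ax|apply: filter_up xy bx]; apply: filtP.
- by split; apply: filter_meet => //; apply: filtP.
Qed.

Definition filt_setI a b : filt X := Filt (is_filter_setI a b).

(* Implicativity of [X] is what makes [a -> b] closed under meets. *)
Lemma is_filter_imp a b :
  is_filter [set x | forall y, x <= y -> a y -> b y]%classic.
Proof.
split=> [|x y xy H z yz|x y Hx Hy z xyz az].
- exists \top => y; rewrite le1x => /eqP -> _; exact: filt_top.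
- by apply: H; apply: le_trans yz.
- set u := imp y z; set v := imp u z.
  have bu : b u.
    apply: Hx; first by rewrite -leIimp.
    by apply: filter_up az; [apply: filtP|rewrite -leIimp leIl].
  have bv : b v.
    apply: Hy; first by rewrite -leIimp meetC leIimp.
    by apply: filter_up az; [apply: filtP|rewrite -leIimp leIl].
  apply: (@filter_up _ _ b (filtP b) (v `&` u)); first by rewrite leIimp.
  by apply: filter_meet => //; apply: filtP.
Qed.

Definition filt_imp a b : filt X := Filt (is_filter_imp a b).

Lemma filt_lexI a b c :
  filt_le a (filt_setI b c) = filt_le a b && filt_le a c.
Proof.
apply/filt_leP/andP => [H|[/filt_leP H1 /filt_leP H2] x ax].
  by split; apply/filt_leP => x /H [].
by split; [apply: H1|apply: H2].
Qed.

Lemma filt_le1 a : filt_le a filt_setT.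
Proof. exact/filt_leP. Qed.

Lemma filt_leIimp a b c :
  filt_le (filt_setI a b) c = filt_le a (filt_imp b c).
Proof.
apply/filt_leP/filt_leP => [H x ax y xy by_|H x [ax bx]].
  by apply: H; split=> //; apply: filter_up xy ax; apply: filtP.
exact: H ax _ (lexx _) bx.
Qed.

End FilterFrame.

Fact filt_display : Order.disp_t. Proof. exact: Order.Disp tt tt. Qed.

HB.instance Definition _ d (X : iFrameType d) := gen_eqMixin (filt X).
HB.instance Definition _ d (X : iFrameType d) := gen_choiceMixin (filt X).
HB.instance Definition _ d (X : iFrameType d) :=
  Order.Le_isPOrder.Build filt_display (filt X)
    (@filt_le_refl d X) (@filt_le_anti d X) (@filt_le_trans d X).
HB.instance Definition _ d (X : iFrameType d) :=
  Order.POrder_isMeetSemilattice.Build filt_display (filt X)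
    (@filt_lexI d X).
HB.instance Definition _ d (X : iFrameType d) :=
  Order.hasTop.Build filt_display (filt X) (@filt_le1 d X).
HB.instance Definition _ d (X : iFrameType d) :=
  isImplicative.Build filt_display (filt X) (@filt_leIimp d X).

Lemma preim_is_filter d d' (X : iFrameType d) (Y : iFrameType d')
  (h : iframe_hom X Y) (b : filt Y) : is_filter [set x | b (h x)]%classic.
Proof.
split=> [|x y xy|x y bx bY] /=.
- by exists \top; rewrite hom_top; apply: filt_top.
- by apply: filter_up (hom_le h xy); apply: filtP.
- by rewrite hom_meet; apply: filter_meet => //; apply: filtP.
Qed.

Definition preim_filt d d' (X : iFrameType d) (Y : iFrameType d')
  (h : iframe_hom X Y) (b : filt Y) : filt X := Filt (preim_is_filter h b).

Record upset d (X : iFrameType d) := Upset {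
  upset_set :> filt X -> Prop;
  upsetP : upclosed upset_set
}.
Arguments upsetP {d X} u [x y].

Section UpsetSemilattice.
Context d (X : iFrameType d).
Implicit Types U V W : upset X.

Lemma upset_ext U V : (forall a, U a <-> V a) -> U = V.
Proof.
case: U V => [U HU] [V HV] /= E.
have {}E : U = V by apply/funext => x; apply/propext.
by subst V; congr Upset; apply: Prop_irrelevance.
Qed.

Definition upset_le U V : bool := `[< forall a, U a -> V a >].

Lemma upset_leP U V : reflect (forall a, U a -> V a) (upset_le U V).
Proof. exact: asboolP. Qed.

Lemma upset_le_refl : reflexive upset_le.
Proof. by move=> U; apply/upset_leP. Qed.

Lemma upset_le_anti : antisymmetric upset_le.
Proof.
move=> U V /andP[/upset_leP UV /upset_leP VU].
by apply: upset_ext => a; split; [apply: UV | apply: VU].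
Qed.

Lemma upset_le_trans : transitive upset_le.
Proof.
by move=> V U W /upset_leP UV /upset_leP VW; apply/upset_leP => a /UV /VW.
Qed.

Lemma upclosed_setT : upclosed [set: filt X].
Proof. by []. Qed.

Definition upset_setT : upset X := Upset upclosed_setT.

Lemma upclosed_setI U V : upclosed [set a | U a /\ V a]%classic.
Proof.
by move=> a b ab [Ua Va]; split;
  [apply: (upsetP U ab) | apply: (upsetP V ab)].
Qed.

Definition upset_setI U V : upset X := Upset (@upclosed_setI U V).

Lemma upset_lexI U V W :
  upset_le U (upset_setI V W) = upset_le U V && upset_le U W.
Proof.
apply/upset_leP/andP => [H|[/upset_leP H1 /upset_leP H2] a Ua].
  by split; apply/upset_leP => a /H [].
by split; [apply: H1|apply: H2].
Qed.

Lemma upset_le1 U : upset_le U upset_setT.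
Proof. exact/upset_leP. Qed.

End UpsetSemilattice.

Fact upset_display : Order.disp_t. Proof. exact: Order.Disp tt tt. Qed.

HB.instance Definition _ d (X : iFrameType d) := gen_eqMixin (upset X).
HB.instance Definition _ d (X : iFrameType d) := gen_choiceMixin (upset X).
HB.instance Definition _ d (X : iFrameType d) :=
  Order.Le_isPOrder.Build upset_display (upset X)
    (@upset_le_refl d X) (@upset_le_anti d X) (@upset_le_trans d X).
HB.instance Definition _ d (X : iFrameType d) :=
  Order.POrder_isMeetSemilattice.Build upset_display (upset X)
    (@upset_lexI d X).
HB.instance Definition _ d (X : iFrameType d) :=
  Order.hasTop.Build upset_display (upset X) (@upset_le1 d X).

Lemma upset_map_up d d' (X : iFrameType d) (Y : iFrameType d')
  (h : iframe_hom X Y) (W : upset X) :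
  upclosed [set b | W (preim_filt h b)]%classic.
Proof.
move=> a b /filt_leP ab; apply: (upsetP W).
by apply/filt_leP => x; apply: ab.
Qed.

Definition upset_map d d' (X : iFrameType d) (Y : iFrameType d')
  (h : iframe_hom X Y) (W : upset X) : upset Y := Upset (@upset_map_up _ _ _ _ h W).

Record dialgebra := Dialgebra {
  dialg_disp : Order.disp_t;
  dialg_frame :> iFrameType dialg_disp;
  dialg_gamma : dialg_frame -> upset dialg_frame;
  dialg_gamma_top : dialg_gamma \top = \top;
  dialg_gamma_meet : forall x y,
    dialg_gamma (x `&` y) = dialg_gamma x `&` dialg_gamma y
}.

Record dialgebra_hom (D E : dialgebra) := DialgebraHom {
  dialg_hom :> iframe_hom D E;
  dialg_homP : forall x,
    upset_map dialg_hom (dialg_gamma x) = dialg_gamma (dialg_hom x)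
}.

Lemma box_is_filter (D : dialgebra) (a : filt D) :
  is_filter [set x : D | dialg_gamma x a]%classic.
Proof.
split=> [|x y xy|x y gx gy] /=.
- by exists \top; rewrite dialg_gamma_top.
- by move/meet_idPl: xy => <-; rewrite dialg_gamma_meet => -[].
- by rewrite dialg_gamma_meet.
Qed.

Definition box (D : dialgebra) (a : filt D) : filt D := Filt (box_is_filter a).

Inductive formula :=
  | FTop
  | FAnd of formula & formula
  | FImp of formula & formula
  | FTri of formula.

Fixpoint sem (D : dialgebra) (phi : formula) : filt D :=
  match phi with
  | FTop => filt_setT D
  | FAnd phi psi => filt_setI (sem D phi) (sem D psi)
  | FImp phi psi => filt_imp (sem D phi) (sem D psi)
  | FTri phi => box (sem D phi)
  end.

Definition logically_equivalent (D : dialgebra) (x y : D) :=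
  forall phi : formula, sem D phi x <-> sem D phi y.

Definition behaviourally_equivalent (D : dialgebra) (p q : D) :=
  exists (E : dialgebra) (f : dialgebra_hom D E), f p = f q.

Lemma eta_is_filter d (X : iFrameType d) (x : X) :
  is_filter [set a : filt X | a x]%classic.
Proof.
split=> [|a b /filt_leP ab|a b] /=.
- by exists \top.
- exact: ab.
- by split.
Qed.

Definition eta d (X : iFrameType d) (x : X) : filt (filt X) :=
  Filt (eta_is_filter x).

(* [tilde a = {q | a \in q}] is the map [eta] of the frame of filters. *)
Definition tilde d (X : iFrameType d) (a : filt X) : filt (filt (filt X)) :=
  eta a.

(* "Clopen" and "closed" are order-theoretic here: no topology is involved. *)
Definition is_clopen d (X : iFrameType d) (U : filt (filt (filt X))) :=
  exists a, U = tilde a.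

Definition is_closed d (X : iFrameType d) (U : filt (filt (filt X))) :=
  forall p, U p <-> (forall C, is_clopen C -> U <= C -> C p).

Section FilterExtension.
Context (D : dialgebra).
Implicit Types (p q : filt (filt D)) (U C : filt (filt (filt D))).

Definition hat_clopen p U := exists a, U = tilde a /\ p (box a).

Definition hat_closed p U :=
  is_closed U /\ forall C, is_clopen C -> U <= C -> hat_clopen p C.

Definition hat_set p U := exists C, C <= U /\ hat_closed p C.

Lemma tilde_le (a b : filt D) : (tilde a <= tilde b) = (a <= b).
Proof.
apply/filt_leP/idP => [H|ab q].
  have F : is_filter [set c : filt D | a <= c]%classic.
    split=> [|x y /= xy ax|x y /= ax ay]; first by exists a => /=.
      exact: le_trans xy.
    by rewrite lexI ax ay.
  exact: (H (Filt F) (lexx a)).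
exact: filter_up (filtP q) _ _ ab.
Qed.

Lemma tilde_inj (a b : filt D) : tilde a = tilde b -> a = b.
Proof.
by move=> E; apply: le_anti; rewrite -!tilde_le E lexx.
Qed.

Lemma hat_clopenE p a : hat_clopen p (tilde a) <-> p (box a).
Proof.
split; last by exists a.
by case=> b [/tilde_inj -> pb].
Qed.

Lemma hat_closedE p U : hat_closed p U <->
  is_closed U /\ forall a, U <= tilde a -> p (box a).
Proof.
split=> -[cU H]; split=> //; [move=> a Ua | move=> C [a ->] Ua].
  by apply/hat_clopenE/H => //; exists a.
exact/hat_clopenE/H.
Qed.

Lemma tilde_closed (a : filt D) : is_closed (tilde a).
Proof.
move=> p; split=> [ap C _ /filt_leP aC|H]; first exact: aC.
by apply: H => //; exists a.
Qed.

Lemma box_le (a b : filt D) : a <= b -> box a <= box b.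
Proof. by move=> ab; apply/filt_leP => x; apply: (upsetP _ ab). Qed.

(* The clauses for clopen, closed and arbitrary filters overlap; the next
   three lemmas show that [hat_set] satisfies each of them literally. *)
Lemma hat_set_tilde p a : hat_set p (tilde a) <-> p (box a).
Proof.
split=> [[C [Ca /hat_closedE[_ H]]]|pa]; first exact: H.
exists (tilde a); split=> //; apply/hat_closedE.
split=> [|b]; first exact: tilde_closed.
by rewrite tilde_le => /box_le ab; apply: filter_up (filtP p) _ _ ab pa.
Qed.

Lemma hat_set_closed p U : is_closed U ->
  hat_set p U <-> (forall C, is_clopen C -> U <= C -> hat_set p C).
Proof.
move=> cU; split=> [[V [VU H]] C _ UC|H].
  by exists V; split=> //; apply: le_trans UC.
exists U; split=> //; apply/hat_closedE; split=> // a Ua.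
by apply/hat_set_tilde/H => //; exists a.
Qed.

Lemma hat_set_filter p U :
  hat_set p U <-> (exists C, [/\ is_closed C, C <= U & hat_set p C]).
Proof.
split=> [[C [CU H]]|[C [cC CU [V [VC H]]]]].
  by exists C; split=> //; [case: H | exists C].
by exists V; split=> //; apply: le_trans CU.
Qed.

Lemma principal_is_filter q : is_filter [set r | q <= r]%classic.
Proof.
split=> [|r s /= rs qr|r s /= qr qs]; first by exists q => /=.
  exact: le_trans rs.
by rewrite lexI qr qs.
Qed.

Definition principal q : filt (filt (filt D)) := Filt (principal_is_filter q).

Lemma principal_le_tilde q a : (principal q <= tilde a) <-> q a.
Proof.
split=> [/filt_leP H|qa]; first exact: (H q (lexx q)).
by apply/filt_leP => r /filt_leP qr; apply: qr.
Qed.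

Lemma principal_le q U : (principal q <= U) <-> U q.
Proof.
split=> [/filt_leP H|Uq]; first exact: (H q (lexx q)).
by apply/filt_leP => r qr; apply: filter_up qr Uq; apply: filtP.
Qed.

Lemma principal_closed q : is_closed (principal q).
Proof.
move=> p; split=> [qp C _ /filt_leP aC|H]; first exact: aC.
apply/filt_leP => a qa; apply: (H (tilde a)); first by exists a.
exact/principal_le_tilde.
Qed.

Lemma closed_principal U : is_closed U -> exists q, U = principal q.
Proof.
move=> cU; have F : is_filter [set a | U <= tilde a]%classic.
  split=> [|a b /= ab Ua|a b /= /filt_leP Ua /filt_leP Ub].
  - by exists \top; apply/filt_leP => r _; apply: filt_top.
  - by apply: le_trans Ua _; rewrite tilde_le.
  - apply/filt_leP => r Ur; apply: filter_meet (filtP r) _ _ _ _.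
      exact: Ua.
    exact: Ub.
exists (Filt F); apply: filt_ext => p; split=> [Up|/filt_leP Hp].
  by apply/filt_leP => a /= /filt_leP; apply.
by apply/cU => C [a ->] Ua; apply: Hp.
Qed.

Lemma hat_setE p U : hat_set p U <->
  exists q : filt (filt D), U q /\ forall a, q a -> p (box a).
Proof.
split=> [[C [CU /hat_closedE[cC H]]]|[q [Uq H]]].
  have [q E] := closed_principal cC; exists q; rewrite {}E in CU H.
  split=> [|a qa]; first exact/principal_le.
  exact/H/principal_le_tilde.
exists (principal q); split; first exact/principal_le.
apply/hat_closedE; split=> [|a /principal_le_tilde]; last exact: H.
exact: principal_closed.
Qed.

Lemma hat_set_up p : upclosed (hat_set p).
Proof.
by move=> U V UV [C [CU H]]; exists C; split=> //; apply: le_trans UV.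
Qed.

Definition hat_gamma p : upset (filt (filt D)) := Upset (@hat_set_up p).

Lemma hat_gamma_top : hat_gamma \top = \top.
Proof.
apply: upset_ext => U; split=> // _; apply/hat_setE.
by exists \top; split=> //; apply: filt_top.
Qed.

Lemma hat_gamma_meet p q : hat_gamma (p `&` q) = hat_gamma p `&` hat_gamma q.
Proof.
apply: upset_ext => U; split.
  move=> /hat_setE[r [Ur H]].
  by split; apply/hat_setE; exists r; split=> // a /H[].
case=> /hat_setE[r [Ur Hr]] /hat_setE[s [Us Hs]]; apply/hat_setE.
exists (r `&` s); split; first by apply: filter_meet => //; apply: filtP.
by move=> a [ra sa]; split; [apply: Hr | apply: Hs].
Qed.

Definition filter_extension : dialgebra :=
  Dialgebra hat_gamma_top hat_gamma_meet.

End FilterExtension.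

(* Main.v *)
(** Truth in the filter extension satisfies [p |= phi] iff [[phi]] belongs to
    [p], and morphisms preserve and reflect truth; this gives the right-to-left
    direction.  For the converse, the definable filters [[phi]] of [D] form an
    implicative meet-semilattice [L] that is closed under [box].  The filters
    of [L], with the analogue of [hat_gamma], form a dialgebra, and [p] mapped
    to its trace [p ∩ L] is a morphism from the filter extension onto it.  It
    identifies [eta x] and [eta y] exactly when [x] and [y] are logically
    equivalent. *)

From HB Require Import structures.
From mathcomp Require Import all_boot all_order.
From mathcomp Require Import boolp classical_sets.
Require Import Defs.

Set Implicit Arguments.
Unset Strict Implicit.
Unset Printing Implicit Defensive.

Import Order.TTheory.
Local Open Scope order_scope.

(** * Truth under morphisms and in the filter extension *)

Lemma sem_dialgebra_hom (D E : dialgebra) (f : dialgebra_hom D E) phi :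
  preim_filt f (sem E phi) = sem D phi.
Proof.
elim: phi => [|phi IHphi psi IHpsi|phi IHphi psi IHpsi|phi IHphi] /=.
- exact: filt_ext.
- by rewrite -IHphi -IHpsi; apply: filt_ext.
- rewrite -IHphi -IHpsi; apply: filt_ext => x; split=> /= H.
    by move=> y /(hom_le f); apply: H.
  (* The back condition turns a test point [y'] above [f x] into an image [f y] with [x <= y], where
     [H] applies. *)
  by move=> y' /hom_back[y [xy <-]]; apply: H.
- by rewrite -IHphi; apply: filt_ext => x /=; rewrite -dialg_homP.
Qed.

Lemma behaviourally_equivalent_logically (D : dialgebra) (x y : D) :
  behaviourally_equivalent x y -> logically_equivalent x y.
Proof.
move=> [E [f fxy]] phi.
by rewrite -(sem_dialgebra_hom f) /= fxy.
Qed.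

(** Supplies the implication case of [sem_filter_extension]. One inclusion tests the hypothesis at
    the least extension of [p] containing [a]; the other is modus ponens inside [q]. *)
Lemma tilde_imp d (X : iFrameType d) (a b : filt X) :
  filt_imp (tilde a) (tilde b) = tilde (filt_imp a b).
Proof.
apply: filt_ext => p; split=> [H|/= pab q /filt_leP pq qa].
  (* [c] lies in the filter generated by [p] and [a] iff [a -> c] is in [p] *)
  have F : is_filter [set c : filt X | p (filt_imp a c)]%classic.
    split=> [|c e ce pc|c e pc pe] /=.
    - exists a; apply: (filter_up (filtP p)) (filt_top p).
      by apply/filt_leP => z _ w _.
    - apply: (filter_up (filtP p)) pc.
      by apply/filt_leP => z H' w zw aw; move/filt_leP: ce; apply; apply: H'.
    - apply: (filter_up (filtP p)) (filter_meet (filtP p) pc pe).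
      by apply/filt_leP => z [Hc He] w zw aw; split; [apply: Hc|apply: He].
  apply: (H (Filt F)) => /=.
    apply/filt_leP => c; apply: (filter_up (filtP p)).
    by apply/filt_leP => z cz w zw _; apply: (filter_up (filtP c)) zw cz.
  apply: (filter_up (filtP p)) (filt_top p).
  by apply/filt_leP => z _ w _.
apply: (filter_up (filtP q)) (filter_meet (filtP q) (pq _ pab) qa).
by apply/filt_leP => z [H az]; apply: H az.
Qed.

(** In the modal case the truth set is clopen by induction, and [hat_set_tilde] computes [hat_gamma]
    on clopen filters. *)
Lemma sem_filter_extension (D : dialgebra) phi :
  sem (filter_extension D) phi = tilde (sem D phi).
Proof.
elim: phi => [|phi IHphi psi IHpsi|phi IHphi psi IHpsi|phi IHphi] /=.
- by apply: filt_ext => p; split=> // _; apply: filt_top.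
- rewrite IHphi IHpsi; apply: filt_ext => p; split=> [[]|H] /=.
    exact: (filter_meet (filtP p)).
  by split; apply: (filter_up (filtP p)) H; apply/filt_leP => z [].
- by rewrite IHphi IHpsi tilde_imp.
- by rewrite IHphi; apply: filt_ext => p; apply: hat_set_tilde.
Qed.

Lemma logically_equivalent_eta (D : dialgebra) (x y : D) :
  @logically_equivalent (filter_extension D) (eta x) (eta y) <->
  logically_equivalent x y.
Proof.
by split=> H phi; move: (H phi); rewrite sem_filter_extension.
Qed.

(** * The implicative semilattice of definable filters *)

Record definable (D : dialgebra) := Definable {
  definable_filt :> filt D;
  definableP : exists phi, definable_filt = sem D phi
}.

Section Definable.
Context (D : dialgebra).
Implicit Types a b c : definable D.

(** Definability only asserts that a formula exists, so proof irrelevance applies: formulas count up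
    to equal truth sets. *)
Lemma definable_inj a b : (a : filt D) = b -> a = b.
Proof.
case: a b => [a Ha] [b Hb] /= E; subst b.
by congr Definable; apply: Prop_irrelevance.
Qed.

Definition definable_sem phi : definable D :=
  Definable (ex_intro _ phi erefl).

Definition definable_top : definable D := definable_sem FTop.

Lemma definable_meet_subproof a b : exists phi, (a : filt D) `&` b = sem D phi.
Proof.
by have [[phi ->] [psi ->]] := (definableP a, definableP b); exists (FAnd phi psi).
Qed.

Definition definable_meet a b := Definable (definable_meet_subproof a b).

Lemma definable_imp_subproof a b : exists phi, imp (a : filt D) b = sem D phi.
Proof.
by have [[phi ->] [psi ->]] := (definableP a, definableP b); exists (FImp phi psi).
Qed.

Definition definable_imp a b := Definable (definable_imp_subproof a b).

Lemma definable_box_subproof a : exists phi, box a = sem D phi.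
Proof. by have [phi ->] := definableP a; exists (FTri phi). Qed.

Definition definable_box a := Definable (definable_box_subproof a).

Definition definable_le a b := (a : filt D) <= b.

Lemma definable_le_refl : reflexive definable_le.
Proof. by move=> a; apply: lexx. Qed.

Lemma definable_le_anti : antisymmetric definable_le.
Proof. by move=> a b /le_anti /definable_inj. Qed.

Lemma definable_le_trans : transitive definable_le.
Proof. by move=> b a c; rewrite /definable_le; apply: le_trans. Qed.

Lemma definable_lexI a b c :
  definable_le a (definable_meet b c) = definable_le a b && definable_le a c.
Proof. exact: lexI. Qed.

Lemma definable_le1 a : definable_le a definable_top.
Proof. exact: lex1. Qed.

Lemma definable_leIimp a b c :
  definable_le (definable_meet a b) c = definable_le a (definable_imp b c).
Proof. exact: leIimp. Qed.

End Definable.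

HB.instance Definition _ (D : dialgebra) := gen_eqMixin (definable D).
HB.instance Definition _ (D : dialgebra) := gen_choiceMixin (definable D).
HB.instance Definition _ (D : dialgebra) :=
  Order.Le_isPOrder.Build filt_display (definable D)
    (@definable_le_refl D) (@definable_le_anti D) (@definable_le_trans D).
HB.instance Definition _ (D : dialgebra) :=
  Order.POrder_isMeetSemilattice.Build filt_display (definable D)
    (@definable_lexI D).
HB.instance Definition _ (D : dialgebra) :=
  Order.hasTop.Build filt_display (definable D) (@definable_le1 D).
HB.instance Definition _ (D : dialgebra) :=
  isImplicative.Build filt_display (definable D) (@definable_leIimp D).

(** * The dialgebra of filters of definables and the trace morphism *)

Section TheoryDialgebra.
Context (D : dialgebra).
Implicit Types (p q : filt (filt D)) (s t : filt (definable D)).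

(** The set mirrors [hat_setE], with [definable_box] for [box], which avoids closed and clopen
    filters. *)
Lemma theory_gamma_up s :
  upclosed [set U : filt (filt (definable D)) |
    exists t, U t /\ forall a, t a -> s (definable_box a)]%classic.
Proof.
by move=> U V /filt_leP UV [t [Ut H]]; exists t; split=> //; apply: UV.
Qed.

Definition theory_gamma s : upset (filt (definable D)) :=
  Upset (@theory_gamma_up s).

Lemma theory_gamma_top : theory_gamma \top = \top.
Proof.
apply: upset_ext => U; split=> // _; exists \top.
by split=> //; apply: filt_top.
Qed.

Lemma theory_gamma_meet s t :
  theory_gamma (s `&` t) = theory_gamma s `&` theory_gamma t.
Proof.
apply: upset_ext => U; split=> [[r [Ur H]]|[[r [Ur Hr]] [u [Uu Hu]]]].
  by split; exists r; split=> // a /H[].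
exists (r `&` u); split; first exact: (filter_meet (filtP U)).
by move=> a [ra ua]; split; [apply: Hr|apply: Hu].
Qed.

Definition theory_dialgebra : dialgebra :=
  Dialgebra theory_gamma_top theory_gamma_meet.

Lemma trace_is_filter p : is_filter [set a : definable D | p a]%classic.
Proof.
split=> [|a b|a b] /=.
- by exists (definable_top D); apply: filt_top.
- exact: (filter_up (filtP p)).
- exact: (filter_meet (filtP p)).
Qed.

Definition trace p : filt (definable D) := Filt (trace_is_filter p).

(** This is the join of [p] with the filter generated by [s] in [filt D], the witness for the back
    condition. *)
Lemma join_is_filter p s :
  is_filter [set c : filt D |
    exists b (e : definable D), [/\ p b, s e & (b `&` e <= c)%O]]%classic.
Proof.
split=> [|c c' cc' [b [e [pb se bec]]]|].
- by exists \top, \top, \top; split; rewrite ?lex1 //; apply: filt_top.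
- by exists b, e; split=> //; apply: le_trans cc'.
- move=> c c' [b [e [pb se bec]]] [b' [e' [pb' se' bec']]].
  exists (b `&` b'), (e `&` e'); split.
  + exact: (filter_meet (filtP p)).
  + exact: (filter_meet (filtP s)).
  + by apply: le_trans (leI2 bec bec'); rewrite meetACA.
Qed.

Definition join_filt p s : filt (filt D) := Filt (join_is_filter p s).

Lemma join_filt_ge p s : p <= join_filt p s.
Proof.
apply/filt_leP => b pb; exists b, \top.
by split=> //; [apply: filt_top|apply: leIl].
Qed.

(* [b /\ e <= c] with [e], [c] definable gives [b <= e -> c], which is again
   definable, hence in [trace p <= s]; modus ponens in [s] yields [c]. *)
Lemma trace_join_filt p s : trace p <= s -> trace (join_filt p s) = s.
Proof.
move=> /filt_leP ps; apply: filt_ext => c; split=> [[b [e [pb se bec]]]|sc].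
  have sec : s (imp e c).
    by apply: ps; apply: (filter_up (filtP p)) pb; rewrite -[_ <= _]leIimp.
  apply: (filter_up (filtP s)) (filter_meet (filtP s) sec se).
  by rewrite leIimp.
by exists \top, c; split; [apply: filt_top| |apply: leIr].
Qed.

Lemma trace_back p s : trace p <= s -> exists q, p <= q /\ trace q = s.
Proof.
by move=> ps; exists (join_filt p s); split; [apply: join_filt_ge|apply: trace_join_filt].
Qed.

Lemma trace_top : trace \top = \top.
Proof. exact: filt_ext. Qed.

Lemma trace_meet p q : trace (p `&` q) = trace p `&` trace q.
Proof. exact: filt_ext. Qed.

Definition trace_iframe_hom : iframe_hom (filt (filt D)) (filt (definable D)) :=
  IFrameHom trace_top trace_meet trace_back.

(** The least filter of [filt D] containing [s]; it gives a right inverse of [trace]. *)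
Lemma upclosure_is_filter s :
  is_filter [set c : filt D | exists2 e : definable D, s e & e <= c :> filt D]%classic.
Proof.
split=> [|c c' cc' [e se ec]|c c' [e se ec] [e' se' ec']].
- by exists \top, \top; [apply: filt_top|apply: lex1].
- by exists e => //; apply: le_trans cc'.
- exists (e `&` e'); first exact: (filter_meet (filtP s)).
  exact: leI2 ec ec'.
Qed.

Definition upclosure s : filt (filt D) := Filt (upclosure_is_filter s).

Lemma trace_upclosure s : trace (upclosure s) = s.
Proof.
apply: filt_ext => c; split=> [[e se ec]|sc]; last by exists c.
exact: (filter_up (filtP s)) se.
Qed.

(** Both sides ask for a witnessing filter: [trace] carries witnesses from left to right,
    [upclosure] from right to left. *)
Lemma trace_gamma p :
  upset_map trace_iframe_hom (hat_gamma p) = theory_gamma (trace p).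
Proof.
apply: upset_ext => U; split.
  by move=> /hat_setE[q [Uq H]]; exists (trace q); split=> // a; apply: H.
move=> [s [Us H]]; apply/hat_setE; exists (upclosure s).
split=> [|c [e /H pe ec]]; first by rewrite /= trace_upclosure.
(* Monotonicity of [box] passes from the definable [e] to an arbitrary [c] above it. *)
exact: (filter_up (filtP p)) (box_le ec) pe.
Qed.

Definition trace_hom : dialgebra_hom (filter_extension D) theory_dialgebra :=
  @DialgebraHom (filter_extension D) theory_dialgebra trace_iframe_hom trace_gamma.

(** [trace (eta x)] collects the truth sets containing [x], so it encodes the theory of [x]. *)
Lemma trace_eta (x y : D) :
  logically_equivalent x y -> trace (eta x) = trace (eta y).
Proof.
by move=> H; apply: filt_ext => -[a aP] /=; have [phi ->] := aP; apply: H.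
Qed.

End TheoryDialgebra.

Theorem theorem8p9 (D : dialgebra) (x y : D) :
  logically_equivalent x y <->
  @behaviourally_equivalent (filter_extension D) (eta x) (eta y).
Proof.
split=> [/trace_eta xy|].
  by exists (theory_dialgebra D), (trace_hom D).
by move=> /behaviourally_equivalent_logically /logically_equivalent_eta.
Qed.
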